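(* Let $R$ be a unitary ring with involution $*$ in which each idempotent element is left $*$-cancellable, and let $a\in R$ be Drazin invertible with Drazin index $\mathrm{i}(a)=k$. Then $a$ is weak group invertible if and only if there exists $x\in R$ such that $(a^{D})^{*}a=(a^{D})^{*}a^{D}x$. In this case, $a^{(\mathrm{W})}=(a^{D})^{3}x$.
   Context: $R$ is an associative ring with identity $1$ equipped with an involution, i.e. a map $a\mapsto a^{*}$ with $(a+b)^{*}=a^{*}+b^{*}$, $(ab)^{*}=b^{*}a^{*}$, $(a^{*})^{*}=a$ for all $a,b\in R$. $\mathbb{N}^{+}$ is the set of positive integers. An element $a\in R$ is left $*$-cancellable if for all $x,y\in R$, $a^{*}ax=a^{*}ay$ implies $ax=ay$. Drazin inverse: $a\in R$ is Drazin invertible if there exist $x\in R$ and $k\in\mathbb{N}^{+}$ with $xa^{k+1}=a^{k}$, $xax=x$, $xa=ax$; such $x$ is unique and denoted $a^{D}$, and the smallest such $k$ is the Drazin index $\mathrm{i}(a)$. Weak group inverse: for $a\in R$, an element $x\in R$ is called a weak group inverse of $a$ if there exists $k\in\mathbb{N}^{+}$ such that $xa^{k+1}=a^{k}$, $ax^{2}=x$, and $(a^{k})^{*}a^{2}x=(a^{k})^{*}a$. $a$ is weak group invertible if it has at least one weak group inverse; when the weak group inverse of $a$ is unique (which is the case for every weak group invertible element in a ring whose idempotents are all left $*$-cancellable) it is denoted $a^{(\mathrm{W})}$. *)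

(* Defs.v *)
From mathcomp Require Import all_boot all_algebra.

Set Implicit Arguments.
Unset Strict Implicit.
Unset Printing Implicit Defensive.

Import GRing.Theory.
Local Open Scope ring_scope.

(* The base structure is pzRingType: associative unitary rings, not assumed
   commutative, and with 1 = 0 allowed. *)

Definition ring_involution (R : pzRingType) (star : R -> R) : Prop :=
  [/\ forall a b, star (a + b) = star a + star b,
      forall a b, star (a * b) = star b * star a
    & forall a, star (star a) = a].

Definition left_star_cancellable (R : pzRingType) (star : R -> R) (a : R) :
  Prop :=
  forall x y, star a * a * x = star a * a * y -> a * x = a * y.

Definition drazin_inverse_at (R : pzRingType) (a : R) (k : nat) (x : R) :
  Prop :=
  [/\ (0 < k)%N, x * a ^+ k.+1 = a ^+ k, x * a * x = x & x * a = a * x].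

Definition drazin_inverse (R : pzRingType) (a x : R) : Prop :=
  exists k, drazin_inverse_at a k x.

(* The index is at least 1, so units have index 1 and not 0. *)
Definition drazin_index (R : pzRingType) (a : R) (k : nat) : Prop :=
  (exists x, drazin_inverse_at a k x) /\
  (forall m, (exists x, drazin_inverse_at a m x) -> (k <= m)%N).

Definition weak_group_inverse (R : pzRingType) (star : R -> R) (a x : R) :
  Prop :=
  exists k, [/\ (0 < k)%N, x * a ^+ k.+1 = a ^+ k, a * x ^+ 2 = x
              & star (a ^+ k) * a ^+ 2 * x = star (a ^+ k) * a].

Definition weak_group_invertible (R : pzRingType) (star : R -> R) (a : R) :
  Prop :=
  exists x, weak_group_inverse star a x.

(* Main.v *)
Require Import Defs.
From mathcomp Require Import all_boot all_algebra.

Set Implicit Arguments.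
Unset Strict Implicit.

Import GRing.Theory.
Local Open Scope ring_scope.

(** Write [d] for the Drazin inverse of [a] and [e = a * d] for the associated
    idempotent.  Any [w] with [a * w ^+ 2 = w] equals [a ^+ j * w ^+ j.+1] for
    every [j], so [w] lies in every right ideal [a ^+ j R] and hence satisfies
    [e * w = w] ([drazin_idem_absorb]).  Both [d] and every weak group inverse
    are of this kind, which has two consequences.

    The powers of [a] in the third defining equation of a weak group inverse
    can be traded for [d], because [d] is a right multiple of [a ^+ m]: a weak
    group inverse [w] satisfies
    [star d * d * (a ^+ 3 * w) = star d * a]
    ([weak_group_inverse_normal_equation]).  So [x = a ^+ 3 * w] solves the
    equation of the theorem, and [w = d ^+ 3 * x]
    ([drazin_exp_cancel]).

    Cancellability of the single idempotent [e] makes [d] itself left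
    star-cancellable, as [star a * star d = star e] and [d = e * d]
    ([drazin_inverse_left_star_cancellable]).  So [d * x] is the same for all
    solutions [x], which yields uniqueness.  Multiplying the equation by
    [d ^+ 3] on the right and cancelling gives [d * x * d ^+ 3 = d ^+ 2], from
    which the axioms for [d ^+ 3 * x] follow
    ([weak_group_inverse_of_normal_equation]). *)

Lemma outer_expand (R : pzRingType) (a x : R) (j : nat) :
  a * x ^+ 2 = x -> a ^+ j * x ^+ j.+1 = x.
Proof.
move=> ax2; elim: j => [|j IHj]; first by rewrite expr0 mul1r expr1.
by rewrite exprSr -[j.+2]/(2 + j)%N exprD -mulrA (mulrA a) ax2 -exprS.
Qed.

Lemma drazin_outer (R : pzRingType) (a d : R) :
  drazin_inverse a d -> a * d ^+ 2 = d.
Proof. by case=> k [_ _ dad da]; rewrite expr2 mulrA -da dad. Qed.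

Lemma drazin_comm (R : pzRingType) (a d : R) :
  drazin_inverse a d -> GRing.comm d a.
Proof. by case=> k []. Qed.

Lemma drazin_idem (R : pzRingType) (a d : R) :
  drazin_inverse a d -> (a * d) * (a * d) = a * d.
Proof. by case=> k [_ _ dad _]; rewrite -mulrA (mulrA d) dad. Qed.

(** [a * d] fixes [a ^+ k] for [k] large, and [w] is a right multiple of every
    power of [a]. *)
Lemma drazin_idem_absorb (R : pzRingType) (a d w : R) :
  drazin_inverse a d -> a * w ^+ 2 = w -> a * d * w = w.
Proof.
case=> k [_ dak _ da] /(@outer_expand _ _ _ k) {1 2}<-.
by rewrite mulrA -da -(mulrA d) -exprS dak.
Qed.

(** [d] is a right multiple of [a ^+ m], so [star d] is a left multiple of
    [star (a ^+ m)]. *)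
Lemma drazin_left_star_multiple (R : pzRingType) (star : R -> R) (a d : R)
    (y z : R) (m : nat) :
  ring_involution star -> drazin_inverse a d ->
  star (a ^+ m) * y = star (a ^+ m) * z -> star d * y = star d * z.
Proof.
move=> [_ starM _] Dd Hyz.
by rewrite -(outer_expand m (drazin_outer Dd)) starM -!mulrA Hyz.
Qed.

(** Multiplying by [star a] on the left turns [star d] into [star (a * d)],
    and [d = a * d * d], so the cancellability of [a * d] applies. *)
Lemma drazin_inverse_left_star_cancellable (R : pzRingType) (star : R -> R)
    (a d : R) :
  ring_involution star -> drazin_inverse a d ->
  left_star_cancellable star (a * d) -> left_star_cancellable star d.
Proof.
move=> [_ starM _] Dd cancel_e y z Hyz.
have ed : a * d * d = d := drazin_idem_absorb Dd (drazin_outer Dd).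
have star_e : star a * star d = star (a * d).
  by rewrite -starM (drazin_comm Dd).
rewrite -ed -!(mulrA (a * d)); apply: cancel_e.
rewrite -!(mulrA (star (a * d))) !(mulrA (a * d)) ed -star_e.
by rewrite -!(mulrA (star a)) !(mulrA (star d)) Hyz.
Qed.

(** As [a * d] fixes [w], the product [d * (a ^+ 3 * w)] is [a ^+ 2 * w]; what
    is left is the third axiom of [w] with [star (a ^+ m)] traded for
    [star d]. *)
Lemma weak_group_inverse_normal_equation (R : pzRingType) (star : R -> R)
    (a d w : R) :
  ring_involution star -> drazin_inverse a d -> weak_group_inverse star a w ->
  star d * d * (a ^+ 3 * w) = star d * a.
Proof.
move=> star_inv Dd [m [_ _ aw2 normal]].
have a2w : d * (a ^+ 3 * w) = a ^+ 2 * w.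
  rewrite (mulrA d) (commrX 3 (drazin_comm Dd)) exprSr.
  by rewrite -(mulrA _ a d) -(mulrA _ (a * d) w) (drazin_idem_absorb Dd aw2).
rewrite -mulrA a2w; apply: (drazin_left_star_multiple (m := m) star_inv Dd).
by rewrite mulrA.
Qed.

(** On elements fixed by [a * d], left multiplication by [d] undoes left
    multiplication by [a]. *)
Lemma drazin_exp_cancel (R : pzRingType) (a d w : R) (n : nat) :
  drazin_inverse a d -> a * w ^+ 2 = w -> d ^+ n * (a ^+ n * w) = w.
Proof.
move=> Dd aw2.
have ew : d * a * w = w by rewrite (drazin_comm Dd) (drazin_idem_absorb Dd).
have step j : d ^+ j.+1 * (a ^+ j.+1 * w) = d ^+ j * (a ^+ j * w).
  rewrite exprSr exprSr -!mulrA (mulrA d) (commrX j (drazin_comm Dd)).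
  by rewrite -!mulrA (mulrA d) ew.
by elim: n => [|n IHn]; rewrite ?step // !expr0 !mul1r.
Qed.

(** In the first two axioms [x] occurs inside [d * x * d ^+ 3], which
    cancelling [d] evaluates to [d ^+ 2].  In the third, [a ^+ 2 * d ^+ 3 = d]
    and [star (a ^+ k)] is a left multiple of [star d], which leaves the
    hypothesis on [x]. *)
Lemma weak_group_inverse_of_normal_equation (R : pzRingType) (star : R -> R)
    (a d x : R) :
  ring_involution star -> drazin_inverse a d -> left_star_cancellable star d ->
  star d * a = star d * d * x -> weak_group_inverse star a (d ^+ 3 * x).
Proof.
move=> [_ starM _] Dd cancel_d Hx.
have ad2 := drazin_outer Dd; have da := drazin_comm Dd.
have a2d3 : a ^+ 2 * d ^+ 3 = d := outer_expand 2 ad2.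
have dxd3 : d * x * d ^+ 3 = d ^+ 2.
  rewrite -mulrA; apply: cancel_d.
  by rewrite mulrA -Hx -!mulrA (exprD d 2 1) (mulrA a) ad2.
have [k [k_gt0 dak dad _]] := Dd.
have dakj j : d ^+ j * a ^+ (j + k) = a ^+ k.
  elim: j => [|j IHj]; first by rewrite expr0 mul1r.
  rewrite exprSr -mulrA addSnnS exprD (mulrA d) (commrX j da).
  by rewrite -(mulrA _ d) dak -exprD.
exists k; split=> //.
- (* A factor [d ^+ 3] split off [a ^+ k.+1] makes [d * x * d ^+ 3] appear. *)
  have ->: a ^+ k.+1 = d ^+ 3 * a ^+ (4 + k).
    by rewrite addSn (exprSr a k) (exprSr a (3 + k)) mulrA dakj.
  rewrite {1}(exprSr d 2) -(mulrA (d ^+ 2) d) -(mulrA (d ^+ 2)).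
  by rewrite (mulrA (d * x)) dxd3 mulrA -exprD dakj.
- rewrite expr2 {1}(exprSr d 2) -(mulrA (d ^+ 2) d) -(mulrA (d ^+ 2)).
  by rewrite (mulrA (d * x)) dxd3 (mulrA a) ad2 mulrA -exprS.
- have star_ak : star (a ^+ k) = star (a ^+ k.+1) * star d.
    by rewrite -starM dak.
  rewrite -(mulrA _ (a ^+ 2)) (mulrA (a ^+ 2)) a2d3 star_ak.
  by rewrite -!(mulrA (star (a ^+ k.+1))) Hx (mulrA (star d)).
Qed.

Theorem proposition3p11 (R : pzRingType) (star : R -> R)
    (star_inv : ring_involution star)
    (idem_cancel : forall e : R, e * e = e -> left_star_cancellable star e)
    (a aD : R) (k : nat)
    (aD_drazin : drazin_inverse a aD) (a_index : drazin_index a k) :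
  (weak_group_invertible star a <->
     exists x : R, star aD * a = star aD * aD * x) /\
  (forall x : R, star aD * a = star aD * aD * x ->
     weak_group_inverse star a (aD ^+ 3 * x) /\
     (forall w : R, weak_group_inverse star a w -> w = aD ^+ 3 * x)).
Proof.
have cancel_d : left_star_cancellable star aD.
  apply: (drazin_inverse_left_star_cancellable star_inv aD_drazin).
  exact: idem_cancel (drazin_idem aD_drazin).
have wg_of x := @weak_group_inverse_of_normal_equation _ _ _ _ x
  star_inv aD_drazin cancel_d.
split.
  split=> [[w Ww] | [x /wg_of Wx]]; last by exists (aD ^+ 3 * x).
  exists (a ^+ 3 * w).
  by rewrite (weak_group_inverse_normal_equation star_inv aD_drazin Ww).
move=> x Hx; split=> [|w Ww]; first exact: wg_of.
have [_ [_ _ aw2 _]] := Ww.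
rewrite -{1}(drazin_exp_cancel 3 aD_drazin aw2) exprSr -!(mulrA (aD ^+ 2)).
congr (_ * _); apply: cancel_d.
by rewrite (weak_group_inverse_normal_equation star_inv aD_drazin Ww).
Qed.
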